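(* Let $R=K[a_1,\dots,a_n]$ be a $K$-algebra generated by $a_1,\dots,a_n$ with a two-sided admissible system $(\mathcal{B},\prec)$, where $\mathcal{B}$ is a skew multiplicative $K$-basis of $R$ and $\prec$ is a two-sided monomial ordering on $\mathcal{B}$. Suppose that, for some permutation $a_{\ell_1},\dots,a_{\ell_n}$ of $a_1,\dots,a_n$, the basis $\mathcal{B}$ contains every monomial $a_{\ell_1}^{\alpha_1}a_{\ell_2}^{\alpha_2}\cdots a_{\ell_n}^{\alpha_n}$ with $\alpha_1,\dots,\alpha_n\in\mathbb{N}$. Suppose that $\mathcal{G}=\Omega\cup G$ is a minimal Gröbner basis of the ideal $I=\langle\mathcal{G}\rangle$, where $\Omega\subset\mathcal{B}$ and $G$ consists of $\frac{n(n-1)}{2}$ elements $$g_{ji}=a_{\ell_j}a_{\ell_i}-\lambda_{ji}a_{\ell_p}a_{\ell_j},\quad 1\le i<j\le n,\ p<j,\ \lambda_{ji}\in K^*\cup\{0\}$$ (where $p$ may depend on $(j,i)$), such that $\mathbf{LM}(g_{ji})=a_{\ell_j}a_{\ell_i}$ for $1\le i<j\le n$. Let $A=R/I$. Then: (i) $N(I)\subseteq\{a_{\ell_1}^{\alpha_1}a_{\ell_2}^{\alpha_2}\cdots a_{\ell_n}^{\alpha_n}\mid\alpha_1,\dots,\alpha_n\in\mathbb{N}\}$, and $\overline{N(I)}$ is a skew multiplicative $K$-basis of $A$. (ii) Let $\prec_I$ be the ordering on $\overline{N(I)}$ induced by the $\mathbb{N}$-graded reverse lexicographic ordering on $\mathbb{N}^n$,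 such that $\overline{a_{\ell_n}}\prec_I\overline{a_{\ell_{n-1}}}\prec_I\cdots\prec_I\overline{a_{\ell_2}}\prec_I\overline{a_{\ell_1}}$. If $\overline{a_{\ell_1}}^{\alpha_1}\overline{a_{\ell_2}}^{\alpha_2}\cdots\overline{a_{\ell_n}}^{\alpha_n}\ne 0$ implies $a_{\ell_1}^{\alpha_1}a_{\ell_2}^{\alpha_2}\cdots a_{\ell_n}^{\alpha_n}\in N(I)$, then $\prec_I$ is a right monomial ordering on $\overline{N(I)}$, and hence $A$ has a right Gröbner basis theory with respect to the right admissible system $(\overline{N(I)},\prec_I)$.
   Context: $K$ is a field, $K^*=K\setminus\{0\}$, $\mathbb{N}$ is the set of nonnegative integers; a $K$-algebra is a finitely generated associative $K$-algebra with identity $1$; an ideal is a two-sided ideal; $\langle S\rangle$ is the two-sided ideal generated by $S$. A skew multiplicative $K$-basis of a $K$-algebra $\Lambda$ generated by $a_1,\dots,a_n$ is a $K$-basis $\mathcal{B}$ consisting of products of powers of the generators such that for all $u,v\in\mathcal{B}$ either $uv=0$ or $uv=\lambda w$ with $\lambda\in K^*$, $w\in\mathcal{B}$. Elements of $\mathcal{B}$ are called monomials. Given a well-ordering $\prec$ on $\mathcal{B}$ and $0\ne f=\sum_{i=1}^s\lambda_iu_i$ with $\lambda_i\in K^*$, $u_i\in\mathcal{B}$, $u_1\prec\cdots\prec u_s$, put $\mathbf{LM}(f)=u_s$; also $\mathbf{LM}(0)=0$. A well-ordering $\prec$ on $\mathcal{B}$ is a two-sided monomial ordering if: (MO1) whenever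 $w,u,v,s\in\mathcal{B}$, $w\prec u$ and $\mathbf{LM}(vws),\mathbf{LM}(vus)\notin K^*\cup\{0\}$, then $\mathbf{LM}(vws)\prec\mathbf{LM}(vus)$; (MO2) for $w,u\in\mathcal{B}$, if $u=\mathbf{LM}(vws)$ for some $v,s\in\mathcal{B}$ with $v\ne1$ or $s\ne1$ (in case $1\in\mathcal{B}$), then $w\prec u$. It is a right monomial ordering if: whenever $w,u,v\in\mathcal{B}$, $w\prec u$ and $\mathbf{LM}(wv),\mathbf{LM}(uv)\notin K^*\cup\{0\}$, then $\mathbf{LM}(wv)\prec\mathbf{LM}(uv)$; and for $w,u\in\mathcal{B}$, if $u=\mathbf{LM}(wv)$ for some $v\in\mathcal{B}$ with $v\ne1$ (in case $1\in\mathcal{B}$), then $w\prec u$. The pair $(\mathcal{B},\prec)$ is then a two-sided (resp. right) admissible system, and an algebra with a skew multiplicative $K$-basis having a two-sided (resp. right) admissible system is said to have a two-sided (resp. right) Gröbner basis theory. For $u,v\in\mathcal{B}$, $u\mid v$ means $v=\lambda wus$ for some $w,s\in\mathcal{B}$, $\lambda\in K^*$. For an ideal $I$ of $R$, a subset $\mathcal{G}\subset I$ of nonzero elements is a Gröbner basis of $I$ if for each nonzero $f\in I$ there is $g\in\mathcal{G}$ with $\mathbf{LM}(g)\mid\mathbf{LM}(f)$; it is minimal if no proper subset is a Gröbner basis of $I$. $N(I)=\{u\in\mathcal{B}\mid\mathbf{LM}(f)\nmid u\text{ for all }0\ne f\in I\}$ is the set of normal monomials. For $f\in R$, $\bar f=f+I$;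 $\overline{N(I)}=\{\bar u\mid u\in N(I)\}$. The ordering $\prec_I$ induced by an ordering $<$ on $\mathbb{N}^n$: $\overline{a_{\ell_1}}^{\alpha_1}\cdots\overline{a_{\ell_n}}^{\alpha_n}\prec_I\overline{a_{\ell_1}}^{\beta_1}\cdots\overline{a_{\ell_n}}^{\beta_n}$ iff $\alpha<\beta$. $\mathbb{N}$-graded reverse lexicographic: with $|\alpha|=\alpha_1+\cdots+\alpha_n$, $\alpha<\beta$ iff $|\alpha|<|\beta|$, or $|\alpha|=|\beta|$ and $\alpha_i>\beta_i$ at the last index $i$ where they differ. *)

(* Defs.v *)
From HB Require Import structures.
From mathcomp Require Import all_boot perm all_algebra.
From mathcomp Require Import boolp classical_sets cardinality.

Set Implicit Arguments.
Unset Strict Implicit.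
Unset Printing Implicit Defensive.

Import GRing.Theory.
Local Open Scope classical_set_scope.
Local Open Scope ring_scope.

Section Ideals.
Variable R : pzRingType.

Definition is_ideal (J : set R) : Prop :=
  [/\ J 0, forall x y, J x -> J y -> J (x + y),
      forall r x, J x -> J (r * x) & forall r x, J x -> J (x * r)].

Record ideal := Ideal { ideal_set :> set R; idealP : is_ideal ideal_set }.

Definition ideal_gen (S : set R) : set R := smallest is_ideal S.

Lemma is_ideal_gen (S : set R) : is_ideal (ideal_gen S).
Proof.
split=> [J [[J0 _ _ _] _]//|x y Jx Jy J HJ|r x Jx J HJ|r x Jx J HJ];
  case: (HJ) => -[? HD Hl Hr] _.
- by apply: HD; [exact: Jx | exact: Jy].
- by apply: Hl; exact: Jx.
- by apply: Hr; exact: Jx.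
Qed.

Definition ideal_pred (I : ideal) : {pred R} := [pred x | `[< ideal_set I x >]].

Lemma ideal_pred_zmod_closed I : zmod_closed (ideal_pred I).
Proof.
case: I => J [J0 JD Jl Jr]; split=> [|x y /asboolP Jx /asboolP Jy].
  exact/asboolP.
apply/asboolP; rewrite /= -mulN1r.
by apply: (JD _ _ Jx); apply: (Jl _ _ Jy).
Qed.

HB.instance Definition _ I :=
  GRing.isZmodClosed.Build R (ideal_pred I) (ideal_pred_zmod_closed I).

End Ideals.

Section Quotient.
Variables (K : fieldType) (R : algType K) (I : ideal R).

Definition quot_alg : Type := Quotient.quot (ideal_pred I).

HB.instance Definition _ := GRing.Zmodule.copy quot_alg
  (Quotient.quot (ideal_pred I)).

Definition residue (x : R) : quot_alg := \pi_(Quotient.quot (ideal_pred I))%qT x.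

Definition lift (x : quot_alg) : R := repr (x : Quotient.quot (ideal_pred I)).

Lemma liftK x : residue (lift x) = x.
Proof. exact: reprK. Qed.

Lemma residue_surj x : exists y, residue y = x.
Proof. by exists (lift x); exact: liftK. Qed.

Lemma residue_eqP x y : residue x = residue y <-> ideal_set I (x - y).
Proof.
split=> [/eqP|Ixy]; first by rewrite /residue -Quotient.idealrBE => /asboolP.
by apply/eqP; rewrite /residue -Quotient.idealrBE; apply/asboolP.
Qed.

Lemma residueD : {morph residue : x y / x + y}.
Proof. by move=> x y; rewrite /residue pi_addr. Qed.

Lemma lift_residue x : ideal_set I (lift (residue x) - x).
Proof. by apply/residue_eqP; rewrite liftK. Qed.

Definition quot_one := residue 1.
Definition quot_mul (x y : quot_alg) := residue (lift x * lift y).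
Definition quot_scale (k : K) (x : quot_alg) := residue (k *: lift x).

Lemma residueM_subproof x y : residue (x * y) = quot_mul (residue x) (residue y).
Proof.
symmetry; apply/residue_eqP; case: (idealP I) => _ ID Il Ir.
have -> : lift (residue x) * lift (residue y) - x * y =
    (lift (residue x) - x) * lift (residue y) + x * (lift (residue y) - y).
  by rewrite mulrBl mulrBr addrA subrK.
by apply: ID; [apply: Ir | apply: Il]; exact: lift_residue.
Qed.

Lemma residueZ_subproof k x : residue (k *: x) = quot_scale k (residue x).
Proof.
symmetry; apply/residue_eqP; case: (idealP I) => _ _ Il _.
rewrite -scalerBr -[_ - _]mul1r scalerAl.
by apply: Il; exact: lift_residue.
Qed.

Lemma quot_mulA : associative quot_mul.
Proof.
move=> x y z; rewrite -[x]liftK -[y]liftK -[z]liftK.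
by rewrite -!residueM_subproof mulrA.
Qed.

Lemma quot_mul1 : left_id quot_one quot_mul.
Proof. by move=> x; rewrite -[x]liftK -residueM_subproof mul1r. Qed.

Lemma quot_mulr1 : right_id quot_one quot_mul.
Proof. by move=> x; rewrite -[x]liftK -residueM_subproof mulr1. Qed.

Lemma quot_mulDl : left_distributive quot_mul +%R.
Proof.
move=> x y z; rewrite -[x]liftK -[y]liftK -[z]liftK.
by rewrite -residueD -!residueM_subproof mulrDl residueD.
Qed.

Lemma quot_mulDr : right_distributive quot_mul +%R.
Proof.
move=> x y z; rewrite -[x]liftK -[y]liftK -[z]liftK.
by rewrite -residueD -!residueM_subproof mulrDr residueD.
Qed.

HB.instance Definition _ := GRing.Zmodule_isPzRing.Build quot_alg
  quot_mulA quot_mul1 quot_mulr1 quot_mulDl quot_mulDr.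

Lemma quot_scaleA k h x : quot_scale k (quot_scale h x) = quot_scale (k * h) x.
Proof. by rewrite -[x]liftK -!residueZ_subproof scalerA. Qed.

Lemma quot_scale1 : left_id 1 quot_scale.
Proof. by move=> x; rewrite -[x]liftK -residueZ_subproof scale1r. Qed.

Lemma quot_scaleDr : right_distributive quot_scale +%R.
Proof.
move=> k x y; rewrite -[x]liftK -[y]liftK.
by rewrite -residueD -!residueZ_subproof scalerDr residueD.
Qed.

Lemma quot_scaleDl x : {morph quot_scale^~ x : k h / k + h}.
Proof.
by move=> k h; rewrite -[x]liftK -!residueZ_subproof scalerDl residueD.
Qed.

HB.instance Definition _ := GRing.Zmodule_isLmodule.Build K quot_alg
  quot_scaleA quot_scale1 quot_scaleDr quot_scaleDl.

Lemma residue1 : residue 1 = 1.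
Proof. by []. Qed.

Lemma residueM : {morph residue : x y / x * y}.
Proof. exact: residueM_subproof. Qed.

Lemma residueZ k : {morph residue : x / k *: x}.
Proof. exact: residueZ_subproof. Qed.

Lemma quot_scalerAl k (x y : quot_alg) : k *: (x * y) = (k *: x) * y.
Proof.
rewrite -[x]liftK -[y]liftK.
by rewrite -residueZ -!residueM -residueZ scalerAl.
Qed.

Lemma quot_scalerAr k (x y : quot_alg) : k *: (x * y) = x * (k *: y).
Proof.
rewrite -[x]liftK -[y]liftK.
by rewrite -residueZ -!residueM -residueZ scalerAr.
Qed.

End Quotient.

(* The library's algType demands 1 <> 0, which fails in R/I when I = R.  So A is
   a possibly zero ring, and sc is its scalar multiplication by K.  In use, sc
   is always the library's *:%R, on an algType or on quot_alg (an algebra by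
   quot_scalerAl and quot_scalerAr above). *)
Section SkewMultiplicativeBases.
Variables (K : fieldType) (A : pzRingType) (sc : K -> A -> A).
Local Notation "k *: x" := (sc k x) : ring_scope.

Definition is_subalgebra (S : set A) : Prop :=
  [/\ S 1, forall x y, S x -> S y -> S (x + y),
      forall (k : K) x, S x -> S (k *: x) & forall x y, S x -> S y -> S (x * y)].

Definition generated_by n (a : 'I_n -> A) : Prop :=
  smallest is_subalgebra (range a) = setT.

Definition linearly_independent (B : set A) : Prop :=
  forall (s : seq A) (c : A -> K), uniq s -> (forall u, u \in s -> B u) ->
    \sum_(u <- s) c u *: u = 0 -> forall u, u \in s -> c u = 0.

Definition spanning (B : set A) : Prop :=
  forall x : A, exists (s : seq A) (c : A -> K),
    (forall u, u \in s -> B u) /\ x = \sum_(u <- s) c u *: u.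

Definition is_basis (B : set A) : Prop := linearly_independent B /\ spanning B.

Definition products_of_powers n (a : 'I_n -> A) : set A :=
  [set x | exists s : seq ('I_n * nat), x = \prod_(k <- s) a k.1 ^+ k.2].

Definition skew_multiplicative_basis n (a : 'I_n -> A) (B : set A) : Prop :=
  [/\ generated_by a, is_basis B, B `<=` products_of_powers a &
      forall u v, B u -> B v -> u * v = 0 \/
        exists (lambda : K) (w : A),
          [/\ lambda != 0, B w & u * v = lambda *: w]].

Variables (B : set A) (prec : A -> A -> Prop).

(* Only the restriction of prec to B is relevant. *)
Definition well_ordering : Prop :=
  [/\ forall u, B u -> ~ prec u u,
      forall u v w, B u -> B v -> B w -> prec u v -> prec v w -> prec u w,
      forall u v, B u -> B v -> [\/ prec u v, u = v | prec v u] &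
      forall S : set A, S `<=` B -> S !=set0 ->
        exists2 m, S m & forall u, S u -> u = m \/ prec m u].

Definition is_leading_monomial (f u : A) : Prop :=
  exists (s : nat) (c : 'I_s.+1 -> K) (w : 'I_s.+1 -> A),
    [/\ forall i, c i != 0, forall i, B (w i),
        forall i j : 'I_s.+1, (i < j)%N -> prec (w i) (w j),
        f = \sum_i c i *: w i & u = w ord_max].

Definition LM (f : A) : A :=
  if f == 0 then 0 else xget 0 [set u | is_leading_monomial f u].

(* The copy of K in A, that is, K^* together with 0. *)
Definition scalars : set A := range (fun k : K => k *: 1).

(* If 1 is not in B, the conditions "v <> 1" below hold automatically. *)
Definition two_sided_monomial_ordering : Prop :=
  [/\ well_ordering,
      forall w u v s, B w -> B u -> B v -> B s -> prec w u ->
        ~ scalars (LM (v * w * s)) -> ~ scalars (LM (v * u * s)) ->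
        prec (LM (v * w * s)) (LM (v * u * s)) &
      forall w u v s, B w -> B u -> B v -> B s -> (v <> 1 \/ s <> 1) ->
        u = LM (v * w * s) -> prec w u].

Definition right_monomial_ordering : Prop :=
  [/\ well_ordering,
      forall w u v, B w -> B u -> B v -> prec w u ->
        ~ scalars (LM (w * v)) -> ~ scalars (LM (u * v)) ->
        prec (LM (w * v)) (LM (u * v)) &
      forall w u v, B w -> B u -> B v -> v <> 1 ->
        u = LM (w * v) -> prec w u].

Definition two_sided_admissible_system n (a : 'I_n -> A) : Prop :=
  skew_multiplicative_basis a B /\ two_sided_monomial_ordering.

Definition right_admissible_system n (a : 'I_n -> A) : Prop :=
  skew_multiplicative_basis a B /\ right_monomial_ordering.

Definition mdivides (u v : A) : Prop :=
  exists (w s : A) (lambda : K),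
    [/\ B w, B s, lambda != 0 & v = lambda *: (w * u * s)].

Definition groebner_basis (I G : set A) : Prop :=
  [/\ G `<=` I, ~ G 0 &
      forall f, I f -> f <> 0 -> exists2 g, G g & mdivides (LM g) (LM f)].

Definition minimal_groebner_basis (I G : set A) : Prop :=
  groebner_basis I G /\ forall G', G' `<` G -> ~ groebner_basis I G'.

Definition normal_monomials (I : set A) : set A :=
  [set u | B u /\ forall f, I f -> f <> 0 -> ~ mdivides (LM f) u].

End SkewMultiplicativeBases.

Definition right_groebner_theory (K : fieldType) (A : pzRingType)
    (sc : K -> A -> A) n (a : 'I_n -> A) : Prop :=
  exists (B : set A) (prec : A -> A -> Prop),
    right_admissible_system sc B prec a.

Definition std_monomial (R : pzRingType) n (b : 'I_n -> R)
    (alpha : {ffun 'I_n -> nat}) : R :=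
  \prod_(k < n) b k ^+ alpha k.

Definition grevlex n (alpha beta : {ffun 'I_n -> nat}) : Prop :=
  (\sum_i alpha i < \sum_i beta i)%N \/
  (\sum_i alpha i = \sum_i beta i)%N /\
    exists i : 'I_n, (beta i < alpha i)%N /\
      forall j : 'I_n, (i < j)%N -> alpha j = beta j.

(* prec is the order on the residues of the standard monomials lying in N that
   is induced by ltN.  As an equivalence, it also requires that the exponent
   comparison not depend on how a residue is written as a standard monomial. *)
Definition induced_ordering (K : fieldType) (R : algType K) n (I : ideal R)
    (b : 'I_n -> R) (N : set R) (ltN : {ffun 'I_n -> nat} -> {ffun 'I_n -> nat} -> Prop)
    (prec : quot_alg I -> quot_alg I -> Prop) : Prop :=
  forall alpha beta : {ffun 'I_n -> nat},
    N (std_monomial b alpha) -> N (std_monomial b beta) ->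
    (prec (std_monomial (residue I \o b) alpha)
          (std_monomial (residue I \o b) beta) <-> ltN alpha beta).

(* Main.v *)
Require Import Defs.
From HB Require Import structures.
From mathcomp Require Import all_boot perm all_algebra.
From mathcomp Require Import boolp classical_sets cardinality.

(* A word in the generators that contains a descent a_j a_i (i < j) is divisible
   by LM(g_ji), so normal monomials are standard. Reducing a monomial modulo an
   element of Omega gives 0, and modulo g_ji it gives a multiple of a smaller
   monomial; hence the residue of every monomial is 0 or a nonzero multiple of
   the residue of a normal one, which is the skew multiplicative structure of A.

   For (ii), the relations a_j a_i = lambda a_p a_j with p < j move a letter
   leftwards through a standard monomial without changing its other letters.
   The moving letter is absorbed at a position q that depends only on the
   exponents to the right of q, and so right multiplication by a letter acts on
   exponents as alpha |-> alpha + e_q, which preserves grevlex. *)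

Set Implicit Arguments.
Unset Strict Implicit.
Unset Printing Implicit Defensive.

Import GRing.Theory.
Local Open Scope classical_set_scope.
Local Open Scope ring_scope.

(** * Coefficients and leading monomials over a linearly independent set *)

Section LeadingMonomials.
Variables (K : fieldType) (A : pzRingType) (sc : K -> A -> A).
Hypothesis scDl : forall x, {morph sc^~ x : k h / k + h}.
Hypothesis sc0r : forall k, sc k 0 = 0.
Variables (B : set A) (prec : A -> A -> Prop).
Hypothesis B_free : linearly_independent sc B.
Hypothesis prec_wo : well_ordering B prec.

Lemma sc0l x : sc 0 x = 0.
Proof. by apply: (addIr (sc 0 x)); rewrite -scDl !add0r. Qed.

Lemma scNl k x : sc (- k) x = - sc k x.
Proof. by apply: (addIr (sc k x)); rewrite -scDl !addNr sc0l. Qed.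

(** An indexed family may repeat a monomial; grouping equal ones gives the duplicate-free sum that
    linear independence speaks of. *)
Lemma collect_terms (J : Type) (r : seq J) (c : J -> K) (w : J -> A) :
  \sum_(i <- r) sc (c i) (w i) =
  \sum_(u <- undup (map w r)) sc (\sum_(i <- r | w i == u) c i) u.
Proof.
(* The list of monomials is generalized to any duplicate-free [U] large enough, so that it stays
   fixed in the induction on [r]. *)
have sub_collect (U : seq A) : uniq U -> {subset map w r <= U} ->
    \sum_(i <- r) sc (c i) (w i) =
    \sum_(u <- U) sc (\sum_(i <- r | w i == u) c i) u.
  move=> uU; elim: r => [|i r IHr] rU.
    by rewrite big_nil big1 // => u _; rewrite big_nil sc0l.
  have iU : w i \in U by apply: rU; rewrite mem_head.
  rewrite big_cons IHr => [|u ur]; last by apply: rU; rewrite inE ur orbT.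
  rewrite [in LHS](bigD1_seq (w i)) //= [in RHS](bigD1_seq (w i)) //= addrA -scDl.
  rewrite [in RHS]big_cons eqxx; congr (_ + _); apply: eq_bigr => u /negPf ui.
  by rewrite big_cons eq_sym ui.
by apply: sub_collect => [|u]; rewrite ?undup_uniq ?mem_undup.
Qed.

Lemma coef_eq0 (J : eqType) (r : seq J) (c : J -> K) (w : J -> A) :
  (forall i, i \in r -> B (w i)) -> \sum_(i <- r) sc (c i) (w i) = 0 ->
  forall u, \sum_(i <- r | w i == u) c i = 0.
Proof.
move=> rB; rewrite collect_terms => /B_free h0 u.
have [ur|ur] := boolP (u \in map w r).
  apply: h0; rewrite ?undup_uniq ?mem_undup // => v.
  by rewrite mem_undup => /mapP[i /rB Bi ->].
apply: big1_seq => i /andP[/eqP iu ir]; case/mapP: ur.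
by exists i.
Qed.

Lemma coef_unique (J J' : eqType) (r : seq J) (r' : seq J') c c' w w' :
  (forall i, i \in r -> B (w i)) -> (forall i, i \in r' -> B (w' i)) ->
  \sum_(i <- r) sc (c i) (w i) = \sum_(i <- r') sc (c' i) (w' i) ->
  forall u, \sum_(i <- r | w i == u) c i = \sum_(i <- r' | w' i == u) c' i.
Proof.
move=> rB r'B eq_rr' u.
(* The difference of the two sums becomes one sum over the disjoint union [J + J']. *)
pose d (j : J + J') := match j with inl i => c i | inr i => - c' i end.
pose z (j : J + J') := match j with inl i => w i | inr i => w' i end.
apply: subr0_eq; have := @coef_eq0 _ (map inl r ++ map inr r') d z _ _ u.
rewrite [X in _ -> _ -> X = 0]big_cat !big_map /= sumrN; apply.
  by move=> j; rewrite mem_cat => /orP[] /mapP[i ir ->]; [apply: rB|apply: r'B].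
rewrite big_cat !big_map /= eq_rr' -big_split big1 // => i _ /=.
by rewrite scNl subrr.
Qed.

(** Total coefficients do not depend on the expansion, so they can be read off the strictly
    increasing one of [is_leading_monomial], where [m] comes last. *)
Lemma leading_coef (J : eqType) (r : seq J) c w f m :
  is_leading_monomial sc B prec f m ->
  (forall i, i \in r -> B (w i)) -> f = \sum_(i <- r) sc (c i) (w i) ->
  \sum_(i <- r | w i == m) c i != 0 /\
  forall u, \sum_(i <- r | w i == u) c i != 0 -> u = m \/ prec u m.
Proof.
case: prec_wo => prec_irr _ _ _ [s [c' [w' [c'0 Bw' w'lt -> ->]]]] rB.
move=> /(coef_unique (fun i _ => Bw' i) rB) coefE.
have w'_inj : injective w'.
  move=> i j eq_w; apply/val_inj/eqP; case: ltngtP => // /w'lt;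
  by rewrite eq_w => /prec_irr [].
split; first by rewrite -coefE (big_pred1 ord_max) // => i; rewrite (inj_eq w'_inj).
move=> u; rewrite -coefE => u0.
have [i /eqP <-] : exists i, w' i == u.
  apply/existsP; apply: contra_neqT u0 => /existsPn wu.
  by apply: big1 => i /(negP (wu i)).
have := leq_ord i; rewrite leq_eqVlt => /orP[/eqP is_max|]; last by right; apply: w'lt.
by left; congr w'; apply/val_inj.
Qed.

Lemma free_neq0 u : B u -> u != 0.
Proof.
move=> Bu; apply/eqP => u0; have := oner_neq0 K.
have /(_ _ _ u) := @coef_eq0 unit [:: tt] (fun=> 1) (fun=> u).
by rewrite !big_seq1 big_mkcond big_seq1 eqxx u0 sc0r => -> //; rewrite ?eqxx -?u0.
Qed.

Lemma sc_free_neq0 k u : k != 0 -> B u -> sc k u != 0.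
Proof.
move=> k0 Bu; apply: contraNneq k0 => ku0.
have /(_ _ _ u) := @coef_eq0 unit [:: tt] (fun=> k) (fun=> u).
by rewrite big_seq1 big_mkcond big_seq1 eqxx => ->.
Qed.

(** [LM] is a choice by [xget], so its value is known once the leading monomial is unique;
    [leading_coef] on the one-term expansion shows this. *)
Lemma LM_monomial k u : k != 0 -> B u -> LM sc B prec (sc k u) = u.
Proof.
move=> k0 Bu; rewrite /LM (negPf (sc_free_neq0 k0 Bu)).
apply: xget_unique => [|m lead_m].
  exists 0, (fun=> k), (fun=> u); split=> // [i j|]; last by rewrite big_ord1.
  by rewrite !ord1.
have [//||+ _] := @leading_coef unit [:: tt] (fun=> k) (fun=> u) _ m lead_m.
  by rewrite big_seq1.
by rewrite big_mkcond big_seq1; case: (u =P m) => [->|] // _; rewrite eqxx.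

Qed.

Lemma LM_leading f : spanning sc B -> f != 0 ->
  is_leading_monomial sc B prec f (LM sc B prec f).
Proof.
move=> B_span f0; rewrite /LM (negPf f0).
apply: (@xgetPex _ 0 [set u | is_leading_monomial sc B prec f u]).
have [s [c [sB fE]]] := B_span f.
pose d u := \sum_(i <- s | i == u) c i.
have {}fE : f = \sum_(u <- undup s) sc (d u) u.
  by rewrite fE (collect_terms _ _ id) map_id.
(* Sorting uses the reflexive closure of [prec]. Its order laws hold only on [B], hence the
   relativized sorting lemmas. *)
pose le u v := `[< prec u v \/ u = v >].
pose t := sort le [seq u <- undup s | d u != 0].
have [prec_irr prec_trans prec_total _] := prec_wo.
have memt u : u \in t = (d u != 0) && (u \in s).
  by rewrite mem_sort mem_filter mem_undup.
have tB : all (mem [pred u | `[< B u >]]) t.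
  by apply/allP => u; rewrite memt => /andP[_ /sB Bu]; apply/asboolP.
have le_trans : {in [pred u | `[< B u >]] & &, transitive le}.
  move=> y x z /asboolP By /asboolP Bx /asboolP Bz /asboolP[xy|->] //.
  move=> /asboolP[yz|<-]; apply/asboolP; left => //.
  exact: prec_trans xy yz.
have ut : uniq t by rewrite sort_uniq filter_uniq ?undup_uniq.
have t_sorted : sorted le t.
  apply: (@sort_sorted_in _ [pred u | `[< B u >]]) => [x y /asboolP Bx /asboolP By|].
    by apply/orP; case: (prec_total x y Bx By) => xy;
      [left|left|right]; apply/asboolP; [left|right|left].
  by rewrite -(@all_sort _ _ le).
have ft : f = \sum_(u <- t) sc (d u) u.
  rewrite [LHS]fE (perm_big _ (permEl (perm_sort _ _))) big_filter /=.
  rewrite [LHS](bigID (fun u => d u != 0)) /= [X in _ + X]big1 ?addr0 //.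
  by move=> u /negPn/eqP ->; rewrite sc0l.
case def_t : t => [|u0 t0]; first by rewrite ft def_t big_nil eqxx in f0.
have szt : size t = (size t0).+1 by rewrite def_t.
pose w (i : 'I_(size t0).+1) := nth 0 t i.
have wt i : w i \in t by rewrite mem_nth ?szt.
exists (w ord_max), (size t0), (d \o w), w; split=> //.
- by move=> i /=; have := wt i; rewrite memt => /andP[].
- by move=> i; have /asboolP := allP tB _ (wt i).
- move=> i j ij; have it (k : 'I_(size t0).+1) : nat_of_ord k \in [pred k | k < size t]%N.
    by rewrite inE szt.
  have /asboolP[//|/eqP] := sorted_ltn_nth_in le_trans 0 tB t_sorted _ _ (it i) (it j) ij.
  by rewrite nth_uniq ?szt ?ltn_ord // (ltn_eqF ij).
- by rewrite ft (big_nth 0) szt big_mkord.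
Qed.

End LeadingMonomials.

(** * The graded reverse lexicographic order on exponents *)

Section GradedReverseLexicographic.
Variable n : nat.
Implicit Types alpha beta gamma : {ffun 'I_n -> nat}.

Local Notation degree alpha := (\sum_i alpha i)%N.

Lemma grevlex_irr alpha : ~ grevlex alpha alpha.
Proof. by case=> [|[_ [i []]]]; rewrite ltnn. Qed.

Lemma grevlex_trans alpha beta gamma :
  grevlex alpha beta -> grevlex beta gamma -> grevlex alpha gamma.
Proof.
move=> [lt_ab|[eq_ab [i [lt_i eq_i]]]] [lt_bg|[eq_bg [j [lt_j eq_j]]]].
- by left; apply: ltn_trans lt_bg.
- by left; rewrite -eq_bg.
- by left; rewrite eq_ab.
right; split; first by rewrite eq_ab.
(* The last difference between [alpha] and [gamma] is at the larger of [i] and [j]. *)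
case: (ltngtP i j) => [ij|ji|/val_inj eq_ij].
- exists j; split=> [|k jk]; first by rewrite eq_i.
  by rewrite eq_i ?eq_j // (ltn_trans ij).
- exists i; split=> [|k ik]; first by rewrite -eq_j.
  by rewrite eq_i ?eq_j // (ltn_trans ji).
- exists i; split=> [|k ik]; last by rewrite eq_i ?eq_j -?eq_ij.
  by apply: ltn_trans lt_i; rewrite eq_ij.
Qed.

Lemma grevlex_total alpha beta :
  [\/ grevlex alpha beta, alpha = beta | grevlex beta alpha].
Proof.
have [lt_ab|lt_ba|eq_ab] := ltngtP (degree alpha) (degree beta).
- by constructor 1; left.
- by constructor 3; left.
have [->|/eqP/ffunP neq_ab] := eqVneq alpha beta; first by constructor 2.
have [i0 i0P] : exists i, alpha i != beta i.
  by apply: contra_notP neq_ab => /forallNP h i; apply/eqP; apply: contra_notT (h i).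
have [i iP i_max] := @arg_maxnP _ i0 (fun i => alpha i != beta i) val i0P.
have eq_i (j : 'I_n) : (i < j)%N -> alpha j = beta j.
  by apply: contraTeq => /i_max; rewrite -leqNgt.
have [lt_i|lt_i|/eqP] := ltngtP (alpha i) (beta i); last by rewrite (negPf iP).
- constructor 3; right; split; first by rewrite eq_ab.
  by exists i; split=> // j ij; rewrite eq_i.
- by constructor 1; right; split=> //; exists i.
Qed.

(* Only finitely many exponents share the smallest degree; among these, take one
   with the fewest predecessors. *)
Lemma grevlex_min (E : set {ffun 'I_n -> nat}) : E !=set0 ->
  exists2 mu, E mu & forall alpha, E alpha -> alpha = mu \/ grevlex mu alpha.
Proof.
move=> [alpha0 E0].
have exd : exists d, `[< exists2 alpha, E alpha & degree alpha = d >].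
  by exists (degree alpha0); apply/asboolP; exists alpha0.
case: (ex_minnP exd) => d /asboolP[beta Ebeta deg_beta] d_min.
have le_d alpha : degree alpha = d -> forall i, (alpha i < d.+1)%N.
  by move=> <- i; rewrite ltnS (bigD1 i) //= leq_addr.
(* Exponents of degree [d] have entries at most [d], so they are encoded in a finite type where
   predecessors can be counted. *)
pose nf (x : {ffun 'I_n -> 'I_d.+1}) := [ffun i => x i : nat].
pose fn alpha : {ffun 'I_n -> 'I_d.+1} := [ffun i => inord (alpha i)].
have fnK alpha : degree alpha = d -> nf (fn alpha) = alpha.
  by move=> /le_d le_alpha; apply/ffunP => i; rewrite !ffunE inordK.
pose P x := `[< E (nf x) /\ degree (nf x) = d >].
have P0 : P (fn beta) by apply/asboolP; rewrite fnK.
pose below x := [set y | P y && `[< grevlex (nf y) (nf x) >]]%SET.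
have [x Px x_min] := @arg_minnP _ (fn beta) P (fun x => #|below x|) P0.
have /asboolP[Ex degx] := Px; exists (nf x) => // alpha Ealpha.
have := d_min _ (asboolT (ex_intro2 _ _ alpha Ealpha erefl)).
rewrite leq_eqVlt => /orP[/eqP deg_alpha|lt_d]; last first.
  by right; left; rewrite degx.
have [||] := grevlex_total alpha (nf x); [move=> lt_x | by left | by move=> ?; right].
have Pa : P (fn alpha) by apply/asboolP; rewrite fnK.
have /x_min := Pa; rewrite leqNgt => /negP[]; apply: proper_card.
apply/properP; split.
  apply/fintype.subsetP => y; rewrite !inE => /andP[-> /asboolP lt_y] /=.
  by apply/asboolP; apply: grevlex_trans lt_y _; rewrite fnK.
exists (fn alpha); rewrite !inE Pa /= ?fnK //; first exact/asboolP.
by apply/asboolP/grevlex_irr.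
Qed.

Definition incr_exp alpha (q : 'I_n) := [ffun i => (alpha i + (q == i))%N].

Lemma degree_incr_exp alpha q : degree (incr_exp alpha q) = (degree alpha).+1.
Proof.
under eq_bigr do rewrite ffunE; rewrite big_split /= -addn1; congr (_ + _)%N.
by rewrite (bigD1 q) //= eqxx big1 // => i /negPf; rewrite eq_sym => ->.
Qed.

(** In equal degree, at the last index [i] where the exponents differ, the hypothesis makes the two
    increments coincide at [i] and to its right; what happens further left does not affect the
    comparison. *)
Lemma grevlex_incr_exp alpha beta q r : grevlex alpha beta ->
  (forall i : 'I_n, (forall j : 'I_n, (i < j)%N -> alpha j = beta j) ->
     forall j : 'I_n, (i <= j)%N -> (q == j) = (r == j)) ->
  grevlex (incr_exp alpha q) (incr_exp beta r).
Proof.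
move=> [lt_ab|[eq_ab [i [lt_i eq_i]]]] qr.
  by left; rewrite !degree_incr_exp.
right; split; first by rewrite !degree_incr_exp eq_ab.
exists i; split=> [|j ij]; rewrite !ffunE (qr i) // ?ltn_add2r //.
  by rewrite eq_i.
exact: ltnW.
Qed.

End GradedReverseLexicographic.

(** * Right multiplication as an action on exponents *)

(** Partial products are written as bounded products over ['I_n], so that induction on the bound
    never changes the index type. *)
Lemma big_ord_ltS (A : pzRingType) n (j : 'I_n) (F : 'I_n -> A) :
  \prod_(i < n | (i < j.+1)%N) F i = (\prod_(i < n | (i < j)%N) F i) * F j.
Proof.
rewrite (big_ord_narrow (ltn_ord j)) big_ord_recr /=.
rewrite (big_ord_narrow (ltnW (ltn_ord j))); congr (_ * F _).
  by apply: eq_bigr => i _; congr F; apply/val_inj.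
exact/val_inj.
Qed.

Section RightMultiplication.
Variables (K : fieldType) (R : algType K) (I : ideal R) (n : nat).
Variables (x : 'I_n -> quot_alg I) (p : 'I_n -> 'I_n -> 'I_n).
Variable lambda : 'I_n -> 'I_n -> K.
Hypothesis p_lt : forall i j : 'I_n, (i < j)%N -> (p j i < j)%N.
Hypothesis x_swap : forall i j : 'I_n, (i < j)%N ->
  x j * x i = lambda j i *: (x (p j i) * x j).
Implicit Types (alpha beta gamma : {ffun 'I_n -> nat}) (q i j : 'I_n).

Lemma iter_p_lt k q j : (q < j)%N -> (iter k (p j) q < j)%N.
Proof. by move=> qj; elim: k => //= k; apply: p_lt. Qed.

(** Each factor [x j] that is crossed applies [p j] once to the moving index, which stays below [j],
    so the relation applies again. *)
Lemma swap_pow k q j : (q < j)%N ->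
  exists c, x j ^+ k * x q = c *: (x (iter k (p j) q) * x j ^+ k).
Proof.
elim: k q => [|k IHk] q qj; first by exists 1; rewrite mul1r mulr1 scale1r.
have [c cE] := IHk _ (p_lt qj); exists (lambda j q * c).
rewrite exprSr -mulrA x_swap // -quot_scalerAr mulrA cE -quot_scalerAl.
by rewrite scalerA -mulrA -exprSr iterSr.
Qed.

(* Moving a letter leftwards past [x_j ^+ alpha_j] for decreasing [j], it is
   absorbed as soon as it reaches its own position; the position [f alpha q]
   where this happens is determined by the exponents to the right of it. *)
Lemma insertion k : (k <= n)%N ->
  exists f : {ffun 'I_n -> nat} -> 'I_n -> 'I_n, forall alpha q, (q < k)%N ->
  [/\ (f alpha q < k)%N,
      exists c, \prod_(i < n | (i < k)%N) x i ^+ alpha i * x q =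
        c *: \prod_(i < n | (i < k)%N) x i ^+ incr_exp alpha (f alpha q) i &
      forall beta i, (i < k)%N ->
        (forall j, (i < j)%N -> alpha j = beta j) ->
        forall j, (i <= j)%N -> (f alpha q == j) = (f beta q == j)].
Proof.
elim: k => [|k IHk] kn; first by exists (fun _ q => q).
have [f fP] := IHk (ltnW kn); pose j := Ordinal kn.
(* [j] is the last index of the enlarged product: the letter [x j] is absorbed there, any other one
   crosses [x j ^+ alpha j] and continues into the shorter product. *)
exists (fun alpha q => if q == j then j else f alpha (iter (alpha j) (p j) q)).
move=> alpha q; rewrite ltnS leq_eqVlt -[k]/(nat_of_ord j) val_eqE.
have [-> _|qj ltqj] := eqVneq q j.
  split=> //; exists 1; rewrite scale1r !big_ord_ltS ffunE eqxx addn1 exprSr mulrA.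
  congr (_ * _ * _); apply: eq_bigr => i ij.
  by rewrite ffunE -val_eqE gtn_eqF // addn0.
have [f_lt [c cE] _] := fP alpha _ (iter_p_lt (alpha j) (ltqj : (q < j)%N)); split.
- by rewrite ltnW.
- have [d dE] := swap_pow (alpha j) ltqj; exists (d * c).
  rewrite !big_ord_ltS -mulrA dE -quot_scalerAr mulrA cE -quot_scalerAl scalerA.
  by rewrite [incr_exp _ _ j]ffunE -val_eqE ltn_eqF // addn0.
(* For [i = j] both positions lie below [j], so neither test succeeds. For [i < j] the exponents
   agree at [j], so the same letter enters the shorter product. *)
move=> beta i; rewrite ltnS leq_eqVlt => /orP[/eqP/val_inj -> _ i'|ij eq_ab i' ii'].
  have [g_lt _ _] := fP beta _ (iter_p_lt (beta j) (ltqj : (q < j)%N)).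
  by move=> ji'; rewrite -!val_eqE !ltn_eqF // (leq_trans _ ji').
have [_ _ f_ext] := fP alpha _ (iter_p_lt (alpha j) (ltqj : (q < j)%N)).
by rewrite (f_ext beta i) // eq_ab.
Qed.

(** The scalar may be 0, and [h] is defined on all exponents even where the product vanishes; this
    lets such maps be composed. *)
Definition degree_multiplier (y : quot_alg I) (d : nat) : Prop :=
  exists h : {ffun 'I_n -> nat} -> {ffun 'I_n -> nat},
  [/\ forall alpha, exists c, std_monomial x alpha * y = c *: std_monomial x (h alpha),
      forall alpha, (\sum_i h alpha i = \sum_i alpha i + d)%N &
      forall alpha beta, grevlex alpha beta -> grevlex (h alpha) (h beta)].

Lemma multiplier1 : degree_multiplier 1 0.
Proof.
exists id; split=> // alpha; last by rewrite addn0.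
by exists 1; rewrite mulr1 scale1r.
Qed.

Lemma multiplierM y z d e :
  degree_multiplier y d -> degree_multiplier z e -> degree_multiplier (y * z) (d + e).
Proof.
move=> [h [hE h_deg h_mono]] [h' [h'E h'_deg h'_mono]].
exists (h' \o h); split=> [alpha|alpha|alpha beta ab] /=.
- have [c cE] := hE alpha; have [c' c'E] := h'E (h alpha); exists (c * c').
  by rewrite mulrA cE -quot_scalerAl c'E scalerA.
- by rewrite h'_deg h_deg addnA.
- exact/h'_mono/h_mono.
Qed.

(** The third clause of [insertion] is the compatibility that [grevlex_incr_exp] asks for. *)
Lemma multiplier_gen q : degree_multiplier (x q) 1.
Proof.
have [f fP] := insertion (leqnn n); exists (fun alpha => incr_exp alpha (f alpha q)).
have prodE alpha : std_monomial x alpha = \prod_(i < n | (i < n)%N) x i ^+ alpha i.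
  by apply: eq_bigl => i; rewrite ltn_ord.
split=> [alpha|alpha|alpha beta ab].
- by rewrite !prodE; have [] := fP alpha q (ltn_ord q).
- by rewrite degree_incr_exp addn1.
- apply: grevlex_incr_exp => // i eq_ab.
  by have [_ _ /(_ beta i (ltn_ord i) eq_ab)] := fP alpha q (ltn_ord q).
Qed.

Lemma multiplier_std gamma : degree_multiplier (std_monomial x gamma) (\sum_i gamma i).
Proof.
apply: big_ind2 => [|y d z e|i _]; [exact: multiplier1 | exact: multiplierM |].
elim: (gamma i) => [|k IHk]; first exact: multiplier1.
by rewrite exprS -add1n; apply: multiplierM => //; apply: multiplier_gen.
Qed.

End RightMultiplication.

(** * Residues and the algebra operations *)

Section Residues.
Variables (K : fieldType) (R : algType K) (I : ideal R).

Lemma residue0 : residue I 0 = 0.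
Proof. by apply: (addIr (residue I 0)); rewrite -residueD !add0r. Qed.

Lemma residue_eq0P x : residue I x = 0 <-> ideal_set I x.
Proof. by rewrite -{2}[x]subr0 -residue_eqP residue0. Qed.

Lemma residue_sum J (r : seq J) P (F : J -> R) :
  residue I (\sum_(i <- r | P i) F i) = \sum_(i <- r | P i) residue I (F i).
Proof. by apply: (big_morph _ (@residueD _ _ I)); exact: residue0. Qed.

Lemma residue_prod J (r : seq J) P (F : J -> R) :
  residue I (\prod_(i <- r | P i) F i) = \prod_(i <- r | P i) residue I (F i).
Proof. by apply: (big_morph _ (@residueM _ _ I)); exact: residue1. Qed.

Lemma residueX x k : residue I (x ^+ k) = residue I x ^+ k.
Proof. by elim: k => [|k IHk]; rewrite ?residue1 // !exprS residueM IHk. Qed.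

Lemma residue_std n (b : 'I_n -> R) alpha :
  residue I (std_monomial b alpha) = std_monomial (residue I \o b) alpha.
Proof. by rewrite residue_prod; apply: eq_bigr => i _; rewrite residueX. Qed.

(** The preimage of a subalgebra containing the residues of the generators is a subalgebra
    containing the generators, hence all of [R]. *)
Lemma generated_by_residue n (a : 'I_n -> R) :
  generated_by (@GRing.scale K R) a -> generated_by (@GRing.scale K (quot_alg I))
    (residue I \o a).
Proof.
move=> a_gen; apply/seteqP; split=> // y _ T [[T1 TD TZ TM] aT].
have [x <-] := residue_surj y.
have : smallest (is_subalgebra (@GRing.scale K R)) (range a) x by rewrite a_gen.
move=> /(_ [set z | T (residue I z)]); apply; split; first split=> /=.
- by rewrite residue1.
- by move=> u v Tu Tv; rewrite residueD; apply: TD.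
- by move=> k u Tu; rewrite residueZ; apply: TZ.
- by move=> u v Tu Tv; rewrite residueM; apply: TM.
- by move=> _ [i _ <-]; apply: aT; exists i.
Qed.

End Residues.

(** * Sorted and unsorted words in the generators *)

Section Words.
Variables (A : pzRingType) (n : nat) (x : 'I_n -> A).

(** All factors to the left of the power of [x i] are 1, so the additional [x i] can be pulled out
    in front. *)
Lemma std_monomial_incr (c : {ffun 'I_n -> nat}) (i : 'I_n) :
  (forall j : 'I_n, (j < i)%N -> c j = 0%N) ->
  std_monomial x (incr_exp c i) = x i * std_monomial x c.
Proof.
move=> c0; suff partial k : (k <= n)%N -> \prod_(j < n | (j < k)%N) x j ^+ incr_exp c i j =
    (if (i < k)%N then x i else 1) * \prod_(j < n | (j < k)%N) x j ^+ c j.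
  have fullE (F : 'I_n -> A) : \prod_(j < n) F j = \prod_(j < n | (j < n)%N) F j.
    by apply: eq_bigl => j; rewrite ltn_ord.
  by rewrite /std_monomial !fullE partial // ltn_ord.
elim: k => [|k IHk] kn; first by rewrite !big_pred0 ?mulr1.
have {IHk} := IHk (ltnW kn); rewrite -[k]/(nat_of_ord (Ordinal kn)).
move: (Ordinal kn) => j IHj; rewrite !big_ord_ltS {}IHj ffunE -val_eqE ltnS.
case: (ltngtP i j) => [ij|ji|/ord_inj eq_ij] /=; rewrite ?addn0 ?mul1r ?mulrA //.
rewrite eq_ij in c0 *; rewrite addn1 exprS mulrA big1 ?mul1r ?mulr1 // => j' /c0 ->.
by rewrite expr0.
Qed.

Lemma sorted_word (s : seq 'I_n) : sorted (relpre val leq) s ->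
  \prod_(i <- s) x i = std_monomial x [ffun i => count_mem i s].
Proof.
elim: s => [_|i s IHs /= i_le].
  by rewrite big_nil /std_monomial big1 // => i _; rewrite ffunE.
have [le_tr s_sorted] : transitive (relpre val leq : rel 'I_n) /\ sorted (relpre val leq) s.
  by split; [move=> j k l; exact: leq_trans | exact: path_sorted i_le].
rewrite big_cons IHs // -std_monomial_incr => [|j ji].
  by congr std_monomial; apply/ffunP => j; rewrite !ffunE /= addnC.
rewrite ffunE; apply/count_memPn; apply: contraL ji => js.
rewrite -leqNgt; exact: (allP (order_path_min le_tr i_le)).
Qed.

Lemma unsorted_word (s : seq 'I_n) : ~~ sorted (relpre val leq) s ->
  exists (s1 s2 : seq 'I_n) (i j : 'I_n), (i < j)%N /\ s = s1 ++ [:: j, i & s2].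
Proof.
elim: s => [|j [|i s] IHs] //; rewrite /= negb_and -ltnNge.
have [ij _|_ /IHs[s1 [s2 [i' [j' [ij' ->]]]]]] := boolP (i < j)%N.
  by exists [::], s, i, j.
by exists (j :: s1), s2, i', j'.
Qed.

End Words.

(** * Monomials under a two-sided monomial ordering *)

Section MonomialAlgebra.
Variables (K : fieldType) (R : algType K) (n : nat) (a : 'I_n -> R).
Variables (B : set R) (prec : R -> R -> Prop).
Hypothesis admissible : two_sided_admissible_system (@GRing.scale K R) B prec a.
Hypothesis B1 : B 1.

Local Notation LMB := (LM (@GRing.scale K R) B prec).

Let scDl (x : R) : {morph (@GRing.scale K R)^~ x : k h / k + h}.
Proof. exact: scalerDl. Qed.

Let sc0r (k : K) : k *: (0 : R) = 0.
Proof. exact: scaler0. Qed.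

Lemma admissible_free : linearly_independent (@GRing.scale K R) B.
Proof. by case: admissible => -[_ []]. Qed.

Lemma admissible_wo : well_ordering B prec.
Proof. by case: admissible => _ []. Qed.

Lemma LM_basis u : B u -> LMB u = u.
Proof.
move=> Bu; rewrite -[X in LMB X]scale1r.
exact: (LM_monomial scDl admissible_free admissible_wo (oner_neq0 K) Bu).
Qed.

Lemma LM_scale k u : k != 0 -> B u -> LMB (k *: u) = u.
Proof. exact: (LM_monomial scDl admissible_free admissible_wo). Qed.

Lemma basis_neq0 u : B u -> u != 0.
Proof. exact: (free_neq0 scDl sc0r admissible_free). Qed.

Lemma basis_ind (P : R -> Prop) :
  (forall u, B u -> (forall v, B v -> prec v u -> P v) -> P u) ->
  forall u, B u -> P u.
Proof.
have [irr _ _ min] := admissible_wo; move=> step u Bu; apply: contrapT => nPu.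
have [||m [Bm nPm] m_min] := min [set v | B v /\ ~ P v]; first by move=> v [].
  by exists u.
apply: nPm; apply: step => // v Bv vm; apply: contrapT => nPv.
have [|vE|mv] := m_min v; first by split.
  by apply: (irr m) => //; rewrite -{1}vE.
have [_ tr _ _] := admissible_wo.
by apply: (irr m) => //; apply: tr mv vm.
Qed.

(** The second axiom is applied to [u = u * 1 * 1]. *)
Lemma one_minimal u : B u -> u = 1 \/ prec 1 u.
Proof.
case: admissible => _ [_ _ mo2] Bu.
have [->|/eqP u1] := eqVneq u 1; [by left | right].
by apply: (mo2 1 u u 1) => //; [left | rewrite !mulr1 LM_basis].
Qed.

(** If [u = k *: 1], then the leading monomial of [u] is both [u] and 1. *)
Lemma basis_not_scalar u : B u -> u <> 1 -> ~ scalars (@GRing.scale K R) u.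
Proof.
move=> Bu u1 [k _ uE]; apply: u1; rewrite -(LM_basis Bu) -uE LM_scale //.
by apply: contraTneq (basis_neq0 Bu) => k0; rewrite -uE k0 scale0r eqxx.
Qed.

(* The scalar k may be 0, so that this class is closed under products. *)
Definition monomial_multiple (y : R) := exists k u, B u /\ y = k *: u.

Lemma monomial_multipleM y z :
  monomial_multiple y -> monomial_multiple z -> monomial_multiple (y * z).
Proof.
case: admissible => -[_ _ _ B_mul] _ [k [u [Bu ->]]] [h [v [Bv ->]]].
have [uv0|[c [w [_ Bw uvE]]]] := B_mul u v Bu Bv.
  by exists 0, 1; rewrite -scalerAl -scalerAr uv0 !scaler0 scale0r.
by exists (k * h * c), w; rewrite -scalerAl -scalerAr uvE !scalerA.
Qed.

Lemma basis_multiple u : B u -> monomial_multiple u.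
Proof. by exists 1, u; rewrite scale1r. Qed.

Lemma nz_monomial_multiple y : monomial_multiple y -> y != 0 ->
  exists k u, [/\ k != 0, B u & y = k *: u].
Proof.
move=> [k [u [Bu ->]]]; have [->|k0 _] := eqVneq k 0; first by rewrite scale0r eqxx.
by exists k, u.
Qed.

(* The first axiom of a monomial ordering says nothing when one of the products
   is a scalar; that case is covered by the minimality of 1. *)
Lemma reduction_lt w s m m' k u c z :
  B w -> B s -> B m -> B m' -> B u -> B z -> k != 0 -> c != 0 ->
  u = k *: (w * m * s) -> w * m' * s = c *: z -> prec m' m -> prec z u.
Proof.
move=> Bw Bs Bm Bm' Bu Bz k0 c0 uE zE m'm.
case: admissible => _ [[irr tr _ _] mo1 mo2].
have LMu : LMB (w * m * s) = u.
  have -> : w * m * s = k^-1 *: u by rewrite uE scalerA mulVf // scale1r.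
  by rewrite LM_scale // invr_neq0.
have LMz : LMB (w * m' * s) = z by rewrite zE LM_scale.
have [ws1|ws1] : w = 1 /\ s = 1 \/ (w <> 1 \/ s <> 1).
  by case: (pselect (w = 1)) => ?; case: (pselect (s = 1)) => ?; tauto.
  by case: ws1 LMu LMz => -> ->; rewrite !mul1r !mulr1 !LM_basis // => <- <-.
have mu : prec m u by apply: (mo2 m u w s).
have u1 : u <> 1.
  move=> u1; case: (one_minimal Bm) => [m1|lt1m].
    by apply: (irr 1) => //; rewrite -{1}m1 -u1.
  by apply: (irr 1) => //; apply: tr lt1m _ => //; rewrite -u1.
have [->|/eqP z1] := eqVneq z 1; first by case: (one_minimal Bu).
rewrite -LMz -LMu; apply: mo1 => //; rewrite ?LMz ?LMu; exact: basis_not_scalar.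
Qed.

(** The products of the outer factors are nonzero because [u] is, so they are nonzero multiples of
    basis monomials. *)
Lemma mdivides_trans x y u : B u ->
  mdivides (@GRing.scale K R) B x y -> mdivides (@GRing.scale K R) B y u ->
  mdivides (@GRing.scale K R) B x u.
Proof.
move=> Bu [w [s [k [Bw Bs k0 ->]]]] [w' [s' [k' [Bw' Bs' k'0 uE]]]].
have uE' : u = (k' * k) *: ((w' * w) * x * (s * s')).
  by rewrite uE -scalerAr -scalerAl scalerA !mulrA.
have [w0 s0] : w' * w != 0 /\ s * s' != 0.
  by split; apply: contraNneq (basis_neq0 Bu) => ws0;
    rewrite uE' ws0 ?mulr0 ?mul0r scaler0.
have [||c [v [c0 Bv vE]]] := @nz_monomial_multiple (w' * w); rewrite ?w0 //.
  by apply: monomial_multipleM; apply: basis_multiple.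
have [||d [t [d0 Bt tE]]] := @nz_monomial_multiple (s * s'); rewrite ?s0 //.
  by apply: monomial_multipleM; apply: basis_multiple.
exists v, t, (k' * k * c * d); split; rewrite ?mulf_neq0 //.
by rewrite uE' vE tE -!scalerAl -scalerAr !scalerA.
Qed.

Lemma word_multiple (b : 'I_n -> R) (s : seq 'I_n) :
  (forall i, B (b i)) -> monomial_multiple (\prod_(i <- s) b i).
Proof.
move=> Bb; apply: big_ind => [||i _]; [|exact: monomial_multipleM|]; exact: basis_multiple.
Qed.

(** * Normal monomials and the skew multiplicative basis of the quotient *)

Section NormalMonomials.
Variable l : 'S_n.
Local Notation b := (a \o l).
Hypothesis B_std : forall alpha, B (std_monomial b alpha).
Variables (Omega G : set R) (I : ideal R) (lambda : 'I_n -> 'I_n -> K).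
Variables (p : 'I_n -> 'I_n -> 'I_n) (g : 'I_n -> 'I_n -> R).
Hypothesis p_lt : forall i j : 'I_n, (i < j)%N -> (p j i < j)%N.
Hypothesis gE : forall i j : 'I_n, (i < j)%N ->
  g j i = b j * b i - lambda j i *: (b (p j i) * b j).
Hypothesis GE : G = [set f | exists i j : 'I_n, (i < j)%N /\ f = g j i].
Hypothesis LM_g : forall i j : 'I_n, (i < j)%N -> LMB (g j i) = b j * b i.
Hypothesis Omega_B : Omega `<=` B.
Hypothesis groebner : groebner_basis (@GRing.scale K R) B prec I (Omega `|` G).

Local Notation N := (normal_monomials (@GRing.scale K R) B prec I).
Local Notation Nbar := (residue I @` N).

Lemma gen_basis i : B (b i).
Proof.
by have := @sorted_word _ _ b [:: i]; rewrite big_seq1 => ->.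
Qed.

Lemma gen2_basis (i j : 'I_n) : (i < j)%N -> B (b i * b j).
Proof.
move=> ij; have := @sorted_word _ _ b [:: i; j]; rewrite big_cons big_seq1 => -> //.
by rewrite /= ltnW.
Qed.

Lemma basis_word u : B u -> exists s : seq 'I_n, u = \prod_(i <- s) b i.
Proof.
case: admissible => -[_ _ B_pow _] _ /B_pow[s ->]; elim: s => [|[i k] s [t IHs]].
  by exists [::]; rewrite !big_nil.
(* The generator [a i] is the letter of [b] with index [l^-1 i]. *)
exists (nseq k ((l^-1)%g i) ++ t); rewrite big_cons IHs big_cat; congr (_ * _).
elim: k => [|k IHk] /=; first by rewrite expr0 big_nil.
by rewrite exprS big_cons /= permKV IHk.
Qed.

Lemma g_ideal (i j : 'I_n) : (i < j)%N -> ideal_set I (g j i).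
Proof. by case: groebner => GI _ _ ij; apply: GI; right; rewrite GE; exists i, j. Qed.

Lemma g_neq0 (i j : 'I_n) : (i < j)%N -> g j i != 0.
Proof.
case: groebner => _ G0 _ ij; apply/eqP => g0; apply: G0.
by right; rewrite GE; exists i, j.
Qed.

Lemma g_leading (i j : 'I_n) : (i < j)%N ->
  is_leading_monomial (@GRing.scale K R) B prec (g j i) (b j * b i).
Proof.
move=> ij; rewrite -LM_g //; have [[_ [_ span] _ _] _] := admissible.
exact: (LM_leading scDl admissible_wo span (g_neq0 ij)).
Qed.

(** The word is not sorted, so membership comes from its being the leading monomial of [g j i]. *)
Lemma inversion_basis (i j : 'I_n) : (i < j)%N -> B (b j * b i).
Proof. by move=> /g_leading[s [c [w [_ Bw _ _ ->]]]]. Qed.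

(* When the two terms of [g j i] involve the same monomial, [g j i] is a nonzero
   multiple of it, which then lies in I. *)
Lemma swap_cases (i j : 'I_n) : (i < j)%N ->
  [\/ lambda j i = 0, ideal_set I (b j * b i) | prec (b (p j i) * b j) (b j * b i)].
Proof.
move=> ij; have [->|lam0] := eqVneq (lambda j i) 0; first by constructor 1.
have [eq_m|neq_m] := eqVneq (b (p j i) * b j) (b j * b i).
  constructor 2; have := gE ij; rewrite eq_m -[X in X - _]scale1r -scalerBl.
  set k := 1 - _ => gk; have k0 : k != 0.
    by apply: contraNneq (g_neq0 ij); rewrite gk => ->; rewrite scale0r.
  have -> : b j * b i = k^-1%:A * g j i by rewrite mulr_algl gk scalerA mulVf ?scale1r.
  by case: (idealP I) => _ _ Il _; apply/Il/g_ideal.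
(* The two monomials are now distinct, so the second one keeps a nonzero coefficient and must lie
   below the leading one. *)
constructor 3; pose r := [:: (1, b j * b i); (- lambda j i, b (p j i) * b j)].
have [||_ /(_ (b (p j i) * b j))] :=
  leading_coef scDl admissible_free admissible_wo
    (r := r) (c := fst) (w := snd) (g_leading ij).
- move=> i'; rewrite !inE => /orP[] /eqP-> /=; first exact: inversion_basis.
  exact/gen2_basis/p_lt.
- by rewrite big_cons big_seq1 /= scale1r scaleNr gE.
rewrite /= in neq_m; rewrite 2!big_cons big_nil /= [a (l j) * _ == _]eq_sym (negPf neq_m).
rewrite eqxx addr0 oppr_eq0 => /(_ lam0)[] // eq_m.
by rewrite -eq_m eqxx in neq_m.
Qed.

Lemma normal_std : N `<=` [set std_monomial b alpha | alpha in setT].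
Proof.
move=> u [Bu u_normal]; have [s us] := basis_word Bu.
have [s_sorted|] := boolP (sorted (relpre val leq) s).
  by exists [ffun i => count_mem i s] => //; rewrite us sorted_word.
move=> /unsorted_word[s1 [s2 [i [j [ij sE]]]]].
case: (u_normal (g j i)); [exact: g_ideal | exact/eqP/g_neq0 |].
have {}us : u = \prod_(i <- s1) b i * (b j * b i) * \prod_(i <- s2) b i.
  by rewrite us sE big_cat !big_cons /= !mulrA.
(* Divisibility needs basis monomials as cofactors; the words around the descent are nonzero
   multiples of such. *)
have [s1_nz s2_nz] : \prod_(i <- s1) b i != 0 /\ \prod_(i <- s2) b i != 0.
  by split; apply: contraNneq (basis_neq0 Bu) => s0; rewrite us s0 ?mulr0 ?mul0r.
have [k [w [k0 Bw wE]]] := nz_monomial_multiple (word_multiple s1 gen_basis) s1_nz.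
have [h [v [h0 Bv vE]]] := nz_monomial_multiple (word_multiple s2 gen_basis) s2_nz.
exists w, v, (k * h); split; rewrite ?mulf_neq0 ?LM_g //.
by rewrite us wE vE -!scalerAl -scalerAr scalerA.
Qed.

(** By induction along [prec]: one reduction step by a Gröbner basis element either shows that the
    residue is 0 or passes to a smaller monomial. *)
Lemma residue_normal w : B w -> residue I w = 0 \/
  exists c u, [/\ c != 0, N u & residue I w = c *: residue I u].
Proof.
have [_ _ Il Ir] := idealP I.
move: w; apply: basis_ind => w Bw IHw.
have [Nw|nNw] := pselect (N w); first by right; exists 1, w; rewrite oner_neq0 scale1r.
have [f [If f0 fw]] : exists f, [/\ ideal_set I f, f <> 0 &
    mdivides (@GRing.scale K R) B (LMB f) w].
  apply: contrapT => nf; apply: nNw; split=> // f If f0 fw; apply: nf.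
  by exists f.
case: groebner => GI _ /(_ f If f0)[g0 Gg0] /mdivides_trans-/(_ _ Bw fw).
move=> [x [y [k [Bx By k0 wE]]]]; have I_dvd m : ideal_set I m ->
    LMB g0 = m -> residue I w = 0.
  move=> Im gm; apply/residue_eq0P; rewrite wE gm -mulr_algl.
  exact/Il/Ir/Il.
case: Gg0 => [Og|].
  left; apply: (I_dvd g0); first by apply: GI; left.
  by rewrite LM_basis //; exact: Omega_B.
rewrite GE => -[i [j [ij gji]]]; have := swap_cases ij.
have LMg : LMB g0 = b j * b i by rewrite gji LM_g.
(* The two representatives differ by a multiple of [x * g j i * y], an element of [I]. *)
have res_w : residue I w = (k * lambda j i) *: residue I (x * (b (p j i) * b j) * y).
  rewrite wE LMg -residueZ; apply/residue_eqP.
  have -> : k *: (x * (b j * b i) * y) - (k * lambda j i) *: (x * (b (p j i) * b j) * y)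
      = k%:A * (x * g j i * y).
    by rewrite mulr_algl gE // mulrBr mulrBl scalerBr -scalerAr -scalerAl scalerA.
  exact/Il/Ir/Il/g_ideal.
case=> [lam0|Im|lt_m].
- by left; rewrite res_w lam0 mulr0 scale0r.
- by left; apply: I_dvd LMg.
have Bm' : B (b (p j i) * b j) by exact/gen2_basis/p_lt.
have := monomial_multipleM (monomial_multipleM (basis_multiple Bx) (basis_multiple Bm'))
  (basis_multiple By).
set m' := x * _ * y in res_w *; have [m0 _|m0 /nz_monomial_multiple] := eqVneq m' 0.
  by left; rewrite res_w m0 residue0 scaler0.
move=> /(_ m0)[c [z [c0 Bz zE]]].
have zw : prec z w.
  apply: (reduction_lt Bx By (inversion_basis ij) Bm' Bw Bz k0 c0 _ zE lt_m).
  by rewrite wE LMg.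
rewrite res_w zE residueZ scalerA; have [->|kl0] := eqVneq (k * lambda j i * c) 0.
  by left; rewrite scale0r.
case: (IHw z Bz zw) => [->|[d [u [d0 Nu ->]]]]; first by left; rewrite scaler0.
by right; exists (k * lambda j i * c * d), u; rewrite mulf_neq0 // scalerA.
Qed.

(** A relation lifts to a combination of normal monomials lying in [I]; were it nonzero, its leading
    monomial would be one of them, against normality. *)
Lemma Nbar_free : linearly_independent (@GRing.scale K (quot_alg I)) Nbar.
Proof.
move=> s c us sN s0 u0 u0s.
pose r u := xget 0 [set v | N v /\ residue I v = u].
have rP u : u \in s -> N (r u) /\ residue I (r u) = u.
  by move=> /sN[v Nv vu]; apply: (@xgetPex _ 0 [set v | N v /\ residue I v = u]); exists v.
have rB u : u \in s -> B (r u) by move=> /rP[[]].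
pose f := \sum_(u <- s) c u *: r u.
have If : ideal_set I f.
  apply/residue_eq0P; rewrite residue_sum -[RHS]s0; apply: eq_big_seq => u /rP[_ uE].
  by rewrite residueZ uE.
have f0 : f = 0.
  apply: contrapT => f_neq0; have [[_ [_ span] _ _] _] := admissible.
  have lead := LM_leading scDl admissible_wo span (introN eqP f_neq0).
  have [coef_nz _] := leading_coef scDl admissible_free admissible_wo lead rB erefl.
  have [u us' rE] : exists2 u, u \in s & r u = LMB f.
    apply: contraTP coef_nz => nu; rewrite big1_seq ?eqxx // => u /andP[/eqP ru us'].
    by case: nu; exists u.
  have [[Bu u_normal] _] := rP u us'; apply: (u_normal f) => //.
  by rewrite rE; exists 1, 1, 1; rewrite oner_neq0 scale1r mul1r mulr1.
have := coef_eq0 scDl admissible_free rB f0 (r u0).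
(* [residue I] inverts [r] on [s], so [r] is injective there and the coefficient of [r u0] in [f] is
   [c u0] alone. *)
rewrite -big_filter (_ : [seq u <- s | r u == r u0] = [:: u0]) ?big_seq1 //.
rewrite -(filter_pred1_uniq us u0s); apply: eq_in_filter => u us' /=.
apply/eqP/eqP => [ru|-> //]; have [_ <-] := rP u us'; have [_ <-] := rP u0 u0s.
by rewrite ru.
Qed.

Lemma Nbar_spanning : spanning (@GRing.scale K (quot_alg I)) Nbar.
Proof.
move=> x; have [y <-] := residue_surj x.
have [[_ [_ span] _ _] _] := admissible; have [s [c [sB ->]]] := span y.
(* The pair [(0, 0)] is a placeholder for vanishing residues and for elements outside [B]. *)
have /choice[dr drP] : forall u, exists kv : K * quot_alg I, B u ->
    residue I u = 0 \/ Nbar kv.2 /\ residue I u = kv.1 *: kv.2.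
  move=> u; have [Bu|nBu] := pselect (B u); last by exists (0, 0).
  have [u0|[d [v [_ Nv uE]]]] := residue_normal Bu; first by exists (0, 0); left.
  by exists (d, residue I v); right; split=> //; exists v.
pose d u := (dr u).1; pose r u := (dr u).2.
pose t := [seq u <- s | residue I u != 0].
have tP u : u \in t -> Nbar (r u) /\ residue I u = d u *: r u.
  by rewrite mem_filter => /andP[/eqP u0 /sB/drP[/u0|]].
(* Different monomials may reduce to the same normal residue, so their coefficients are added. *)
exists (undup (map r t)), (fun v => \sum_(u <- t | r u == v) c u * d u); split.
  by move=> v; rewrite mem_undup => /mapP[u /tP[Nu _] ->].
have /(_ _ t (fun u => c u * d u) r) <- :=
  @collect_terms K (quot_alg I) (@GRing.scale K (quot_alg I)) (fun x => scalerDl x).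
rewrite residue_sum big_filter.
rewrite (bigID (fun u => residue I u != 0)) /= [X in _ + X]big1 ?addr0; last first.
  by move=> u /negPn/eqP u0; rewrite residueZ u0 scaler0.
rewrite -!(big_filter s); apply: eq_big_seq => u /tP[_ uE].
by rewrite residueZ uE scalerA.
Qed.

Lemma Nbar_skew_basis :
  skew_multiplicative_basis (@GRing.scale K (quot_alg I)) (residue I \o a) Nbar.
Proof.
have [[a_gen _ B_pow B_mul] _] := admissible; split.
- exact: generated_by_residue.
- by split; [exact: Nbar_free | exact: Nbar_spanning].
- move=> _ [u [Bu _] <-]; have [s ->] := B_pow u Bu; exists s.
  by rewrite residue_prod; apply: eq_bigr => k _; rewrite residueX.
- move=> _ _ [u [Bu _] <-] [v [Bv _] <-]; rewrite -residueM.
  have [->|[k [w [k0 Bw ->]]]] := B_mul u v Bu Bv; first by left; rewrite residue0.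
  rewrite residueZ; have [->|[c [z [c0 Nz ->]]]] := residue_normal Bw.
    by left; rewrite scaler0.
  by right; exists (k * c), (residue I z); rewrite mulf_neq0 // scalerA; split=> //; exists z.
Qed.

(** * The induced ordering as a right monomial ordering *)

Section InducedOrdering.
Local Notation bbar := (residue I \o b).
Variable precI : quot_alg I -> quot_alg I -> Prop.
Hypothesis precI_grevlex : induced_ordering b N (@grevlex n) precI.
Hypothesis std_normal : forall alpha,
  std_monomial bbar alpha <> 0 -> N (std_monomial b alpha).

Local Notation LMI := (LM (@GRing.scale K (quot_alg I)) Nbar precI).

Lemma Nbar_std y : Nbar y <->
  exists alpha, N (std_monomial b alpha) /\ y = std_monomial bbar alpha.
Proof.
split=> [[u Nu <-]|[alpha [Na ->]]]; last first.
  by exists (std_monomial b alpha) => //; rewrite residue_std.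
have [alpha _ uE] := normal_std Nu.
by exists alpha; rewrite uE; split=> //; rewrite -uE residue_std.
Qed.

Lemma swap_residue (i j : 'I_n) : (i < j)%N ->
  bbar j * bbar i = lambda j i *: (bbar (p j i) * bbar j).
Proof.
move=> ij /=; rewrite -!residueM -residueZ; apply/residue_eqP.
by have := g_ideal ij; rewrite gE.
Qed.

Lemma Nbar_wo : well_ordering Nbar precI.
Proof.
split.
- by move=> _ /Nbar_std[alpha [Na ->]] /(precI_grevlex Na Na)/grevlex_irr.
- move=> _ _ _ /Nbar_std[alpha [Na ->]] /Nbar_std[beta [Nb ->]] /Nbar_std[gamma [Nc ->]].
  move=> /(precI_grevlex Na Nb) ab /(precI_grevlex Nb Nc) bc.
  exact/(precI_grevlex Na Nc)/(grevlex_trans ab).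
- move=> _ _ /Nbar_std[alpha [Na ->]] /Nbar_std[beta [Nb ->]].
  by have [ab|->|ba] := grevlex_total alpha beta;
    [constructor 1; apply/precI_grevlex | constructor 2 | constructor 3; apply/precI_grevlex].
- move=> S SN [y Sy].
  pose E := [set alpha | N (std_monomial b alpha) /\ S (std_monomial bbar alpha)].
  have [|mu [Nmu Smu] mu_min] := @grevlex_min _ E.
    by have /Nbar_std[alpha [Na yE]] := SN _ Sy; exists alpha; rewrite /E /= -yE.
  exists (std_monomial bbar mu) => // z Sz; have /Nbar_std[alpha [Na zE]] := SN _ Sz.
  rewrite zE; have [|->|lt_mu] := mu_min alpha; [by rewrite /E /= -zE | by left |].
  by right; apply/precI_grevlex.
Qed.

(** By [std_normal] a nonvanishing standard monomial of the quotient is the residue of a normal one,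
    hence a basis element. *)
Lemma LM_std y alpha c : y = c *: std_monomial bbar alpha -> y <> 0 ->
  N (std_monomial b alpha) /\ LMI y = std_monomial bbar alpha.
Proof.
move=> -> nz; have c0 : c != 0 by apply/eqP => c0; apply: nz; rewrite c0 scale0r.
have Na : N (std_monomial b alpha).
  by apply: std_normal => a0; apply: nz; rewrite a0 scaler0.
split=> //; apply: (LM_monomial (fun x : quot_alg I => @scalerDl K _ x) Nbar_free Nbar_wo c0).
by apply/Nbar_std; exists alpha.
Qed.

Lemma right_monomial_ordering_Nbar :
  right_monomial_ordering (@GRing.scale K (quot_alg I)) Nbar precI.
Proof.
have LM0 : LMI 0 = 0 by rewrite /LM eqxx.
have scalars0 : scalars (@GRing.scale K (quot_alg I)) 0.
  by exists 0; rewrite ?scale0r.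
split; first exact: Nbar_wo.
- move=> _ _ _ /Nbar_std[alpha [Na ->]] /Nbar_std[beta [Nb ->]] /Nbar_std[gamma [_ ->]].
  move=> /(precI_grevlex Na Nb) ab.
  have [h [hE _ h_mono]] := multiplier_std p_lt swap_residue gamma.
  have [c cE] := hE alpha; have [d dE] := hE beta.
  (* Since [LMI 0 = 0] is a scalar, the side conditions of the axiom make both products nonzero. *)
  have nz y : ~ scalars (@GRing.scale K (quot_alg I)) (LMI y) -> y <> 0.
    by move=> + y0; rewrite y0 LM0.
  move=> /nz/(LM_std cE)[Nha ->] /nz/(LM_std dE)[Nhb ->].
  exact/precI_grevlex/h_mono.
- move=> _ u _ /Nbar_std[alpha [Na ->]] Nu /Nbar_std[gamma [_ ->]] gamma1.
  have [h [hE h_deg _]] := multiplier_std p_lt swap_residue gamma.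
  have [c cE] := hE alpha; move=> uE.
  (* A zero product would give [u = LMI 0 = 0], which is not in the linearly independent [Nbar]. *)
  have nz : std_monomial bbar alpha * std_monomial bbar gamma <> 0.
    move=> y0; move: uE Nu; rewrite y0 LM0 => -> N0.
    have scD (x : quot_alg I) := @scalerDl K _ x.
    by have := free_neq0 scD (fun k => scaler0 _ k) Nbar_free N0; rewrite eqxx.
  have [Nh LMh] := LM_std cE nz; rewrite uE LMh; apply/precI_grevlex => //.
  (* The degree grows by that of [gamma], which is positive because its monomial is not 1. *)
  left; rewrite h_deg -addn1 leq_add2l lt0n; apply: contra_notN gamma1 => /eqP gamma0.
  rewrite /std_monomial big1 // => i _; move: gamma0; rewrite (bigD1 i) //=.
  by move=> /eqP; rewrite addn_eq0 => /andP[/eqP -> _]; rewrite expr0.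
Qed.

End InducedOrdering.
End NormalMonomials.
End MonomialAlgebra.

Theorem theorem2p3 (K : fieldType) (R : algType K) (n : nat) (a : 'I_n -> R)
    (B : set R) (prec : R -> R -> Prop)
    (hB : two_sided_admissible_system (@GRing.scale K R) B prec a)
    (l : 'S_n)
    (hstd : forall alpha : {ffun 'I_n -> nat}, B (std_monomial (a \o l) alpha))
    (Omega G : set R) (I : ideal R)
    (lambda : 'I_n -> 'I_n -> K) (p : 'I_n -> 'I_n -> 'I_n)
    (g : 'I_n -> 'I_n -> R)
    (hp : forall i j : 'I_n, (i < j)%N -> (p j i < j)%N)
    (hg : forall i j : 'I_n, (i < j)%N ->
      g j i = a (l j) * a (l i) - lambda j i *: (a (l (p j i)) * a (l j)))
    (hG : G = [set f | exists i j : 'I_n, (i < j)%N /\ f = g j i])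
    (hGcard : (G #= `I_((n * n.-1) %/ 2))%card)
    (hLM : forall i j : 'I_n, (i < j)%N ->
      LM (@GRing.scale K R) B prec (g j i) = a (l j) * a (l i))
    (hOmega : Omega `<=` B)
    (hI : I = ideal_gen (Omega `|` G) :> set R)
    (hGB : minimal_groebner_basis (@GRing.scale K R) B prec I (Omega `|` G)) :
  let N := normal_monomials (@GRing.scale K R) B prec I in
  let Nbar := residue I @` N in
  let abar := residue I \o a in
  let scA := @GRing.scale K (quot_alg I) in
  (N `<=` [set std_monomial (a \o l) alpha | alpha in setT] /\
   skew_multiplicative_basis scA abar Nbar) /\
  (forall precI : quot_alg I -> quot_alg I -> Prop,
     induced_ordering (a \o l) N (@grevlex n) precI ->
     (forall i j : 'I_n, (i < j)%N -> precI (abar (l j)) (abar (l i))) ->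
     (forall alpha : {ffun 'I_n -> nat},
        std_monomial (abar \o l) alpha <> 0 -> N (std_monomial (a \o l) alpha)) ->
     [/\ right_monomial_ordering scA Nbar precI,
         right_admissible_system scA Nbar precI abar &
         right_groebner_theory scA abar]).
Proof.
(* 1 is the standard monomial with all exponents 0. *)
have B1 : B 1.
  have := hstd [ffun=> 0%N]; rewrite /std_monomial big1 // => i _.
  by rewrite ffunE expr0.
have [hGB' _] := hGB.
have basis_N := Nbar_skew_basis hB B1 hstd hp hg hG hLM hOmega hGB'.
split; first by split=> //; exact: (normal_std hB B1 hstd hG hLM hGB').
move=> precI precIE _ std_N.
have ordering_N := right_monomial_ordering_Nbar hB B1 hstd hp hg hG hLM hGB' precIE std_N.
by split=> //; exists (residue I @` normal_monomials (@GRing.scale K R) B prec I), precI.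
Qed.
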